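(* Let $0<\alpha<1$ and $f\in\Lambda_\alpha(\mathbb{R}^d)$. Let $p\in\mathbb{N}$, $a_1,\dots,a_p\in\mathbb{R}^d$ and $\mu_1,\dots,\mu_p\in\mathbb{R}$ be such that $\sum_{i=1}^p\mu_i=0$. Define $$\Gamma_\varepsilon f(x):=\int_\varepsilon^1\frac{\sum_{i=1}^p\mu_i f(x+a_ih)}{h^\alpha}\,\frac{dh}{h},\qquad x\in\mathbb{R}^d.$$ Then there exists a positive constant $C$ depending only on $d$, $\alpha$, $\|f\|_\alpha$ and $a_1,\dots,a_p$ such that $$\limsup_{\varepsilon\to0}\frac{|\Gamma_\varepsilon f(x)|}{\sqrt{\log(1/\varepsilon)\,\log\log\log(1/\varepsilon)}}\leq C$$ for almost all $x\in\mathbb{R}^d$.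
   Context: For $0<\alpha<1$, $\Lambda_\alpha(\mathbb{R}^d)$ is the space of functions $f:\mathbb{R}^d\to\mathbb{R}$ with $\|f\|_\alpha:=\sup\frac{|f(x+h)-f(x)|}{|h|^\alpha}<\infty$, the supremum being over all $x\in\mathbb{R}^d$ and $h\in\mathbb{R}^d\setminus\{0\}$.
   Formalization: The constant C is allowed to depend also on the sum of |μ_i|, besides d, α, ‖f‖_α and a_1,…,a_p, because Γ_ε f is linear in μ, so a C independent of μ fails for lacunary f when μ is rescaled. *)

(* Defs.v *)
From HB Require Import structures.
From mathcomp Require Import all_boot all_order all_algebra.
From mathcomp Require Import all_classical all_reals all_analysis.

Set Implicit Arguments.
Unset Strict Implicit.
Unset Printing Implicit Defensive.

Import Order.TTheory GRing.Theory Num.Theory.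
Import numFieldNormedType.Exports.

Local Open Scope classical_set_scope.
Local Open Scope ring_scope.

(* The canonical norm of 'rV[R]_d is the sup norm, hence this definition. *)
Definition euclidean_norm (R : realType) (d : nat) (x : 'rV[R]_d) : R :=
  Num.sqrt (\sum_(i < d) (x ord0 i) ^+ 2).

Definition holder_norm (R : realType) (d : nat) (alpha : R)
    (f : 'rV[R]_d -> R) : \bar R :=
  ereal_sup [set e : \bar R | exists x h : 'rV[R]_d, h != 0 /\
    e = (`|f (x + h) - f x| / (euclidean_norm h `^ alpha))%:E].

Definition Lambda (R : realType) (d : nat) (alpha : R) :
    set ('rV[R]_d -> R) :=
  [set f | (holder_norm alpha f < +oo)%E].

Definition open_box (R : realType) (d : nat) (u v : 'rV[R]_d) :
    set 'rV[R]_d :=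
  [set x | forall i, u ord0 i < x ord0 i < v ord0 i].

Definition box_volume (R : realType) (d : nat) (u v : 'rV[R]_d) : R :=
  \prod_(i < d) (v ord0 i - u ord0 i).

(* Lebesgue outer measure on R^d, for d >= 1. For d = 0 no box is empty, so
   every cover has infinite total volume and the value is always +oo. *)
Definition lebesgue_outer (R : realType) (d : nat) (A : set 'rV[R]_d) :
    \bar R :=
  ereal_inf [set s : \bar R | exists u v : nat -> 'rV[R]_d,
    [/\ forall k i, u k ord0 i <= v k ord0 i,
        A `<=` \bigcup_k open_box (u k) (v k) &
        s = (\sum_(0 <= k <oo) (box_volume (u k) (v k))%:E)%E]].

(* The Lebesgue null sets are exactly the sets of zero outer measure, so no
   measurability of P is involved. *)
Definition almost_all (R : realType) (d : nat) (P : 'rV[R]_d -> Prop) : Prop :=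
  lebesgue_outer [set x | ~ P x] = 0%E.

Definition Gamma (R : realType) (d p : nat) (alpha : R)
    (a : 'I_p -> 'rV[R]_d) (mu : 'I_p -> R) (f : 'rV[R]_d -> R)
    (eps : R) (x : 'rV[R]_d) : R :=
  (\int[lebesgue_measure]_(h in `[eps, 1])
    ((\sum_(i < p) mu i * f (x + h *: a i)) / (h `^ alpha) / h))%R.

Definition log3_gauge (R : realType) (eps : R) : R :=
  Num.sqrt (ln eps^-1 * ln (ln (ln eps^-1))).

(* Main.v *)
From HB Require Import structures.
Require Import Defs.
From mathcomp Require Import all_boot all_order all_algebra.
From mathcomp Require Import all_classical all_reals all_analysis.
From mathcomp Require Import ring lra zify.

Set Implicit Arguments.
Unset Strict Implicit.
Unset Printing Implicit Defensive.

Import Order.TTheory GRing.Theory Num.Theory.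
Import numFieldNormedType.Exports.

Local Open Scope classical_set_scope.
Local Open Scope ring_scope.

(** Why the bound holds.

    Write [F_n] for [Gamma] at the scale [2^-n].  Since the weights sum to
    zero and [f] is Hoelder continuous, the part of the integral over a
    dyadic range of [h] is bounded, so only the growth of [F_n] matters, and
    [F_n] oscillates by a bounded amount on a dyadic cube of side [2^-n].
    The claim is then that [F_n] obeys the upper half of a law of the
    iterated logarithm: [log (1/eps)] counts the scales, so that
    [log log log (1/eps)] is the iterated logarithm of the number of scales.

    The source of the cancellation is that [F_n] is a dyadic martingale up to
    a bounded error.  For a fixed horizon [N] let [S_n x] be the mean of [F_N]
    over the points of the lattice [2^-N Z^d] in the cube of side [2^-n] at
    [x].  It is a martingale on the dyadic tree by construction.  The
    difference [S_n - F_n] is, up to the oscillation of [F_n] on a cube, the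
    mean of the contributions of the scales [2^-k] with [n <= k < N].  A mean over the cube is almost invariant under the
    translations [h *: a i]: a shift by one lattice step along an axis only
    exchanges two opposite faces, a proportion [2^-(N - n)] of the points
    ([cube_avg_increment_vector]).  Hence scale [k] contributes at most a
    multiple of [2^-((k - n) (1 - alpha)) + 2^-((N - k) alpha)], where the
    second term is the cost of rounding a shift to the lattice, and the sum
    over [k] is bounded independently of [n] and [N]
    ([cube_avg_Gamma_dyad]).  Working with finite means rather than with
    integrals over cubes keeps the whole argument on finite trees.

    For a martingale with bounded increments on the dyadic tree, the
    exponential supermartingale argument bounds the measure of the cubes that
    meet a large value ([tree_maximal_inequality]); it is an induction from
    the leaves of the tree to its root that only uses the subadditivity of
    the outer measure.  With horizons [N = 2^k] and levels of order
    [sqrt (2^k log k)] the exceptional sets have outer measure of order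
    [k^-2], and the Borel-Cantelli argument gives the law of the iterated
    logarithm ([dyadic_lil]). *)

(** * The outer measure of R^d *)

Section OuterMeasure.
Context {R : realType}.
Local Open Scope ereal_scope.

Lemma box_volume_ge0 d (u v : 'rV[R]_d) :
  (forall i, u ord0 i <= v ord0 i)%R -> (0 <= box_volume u v)%R.
Proof. by move=> uv; apply: prodr_ge0 => i _; rewrite subr_ge0. Qed.

Lemma lebesgue_outer_ge0 d (A : set 'rV[R]_d) : 0 <= lebesgue_outer A.
Proof.
apply: le_ereal_inf_tmp => _ [u [v [uv _ ->]]].
by apply: nneseries_ge0 => k _ _; rewrite lee_fin box_volume_ge0.
Qed.

Lemma lebesgue_outer_le d : {homo @lebesgue_outer R d : A B / A `<=` B >-> A <= B}.
Proof.
move=> A B AB; apply: ereal_inf_le_tmp => _ [u [v [uv Buv ->]]].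
by exists u, v; split => //; exact: subset_trans Buv.
Qed.

(** The positive dimension matters: a degenerate box then has volume zero and
    can fill up a finite cover to an infinite one. *)
Lemma lebesgue_outer_box d (u v : 'rV[R]_d.+1) :
  (forall i, u ord0 i <= v ord0 i)%R ->
  lebesgue_outer (open_box u v) <= (box_volume u v)%:E.
Proof.
move=> uv; apply: ereal_inf_lbound.
exists (fun k => if k == 0%N then u else 0%R), (fun k => if k == 0%N then v else 0%R).
split => [[|k] i|x uxv|].
- exact: uv.
- by rewrite !mxE.
- by exists 0%N.
rewrite nneseries_recl//; last first.
  by move=> [|k] _; rewrite lee_fin box_volume_ge0// => i; rewrite mxE.
rewrite eseries_cond/= eseries0 ?adde0// => -[|k]//= _ _.
by rewrite /box_volume big_ord_recl !mxE subrr mul0r.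
Qed.

Lemma lebesgue_outer0 d : @lebesgue_outer R d.+1 set0 = 0.
Proof.
apply/eqP; rewrite eq_le lebesgue_outer_ge0 andbT.
apply: (@le_trans _ _ (lebesgue_outer (open_box (0 : 'rV[R]_d.+1) 0))%R).
  exact: lebesgue_outer_le.
apply: le_trans (lebesgue_outer_box _) _ => //.
by rewrite /box_volume big_ord_recl !mxE subrr mul0r.
Qed.

(** Covers that are optimal up to [e / 2^(n+1)] are merged along a bijection
    between [nat] and [nat * nat]. *)
Lemma lebesgue_outer_sigma_subadditive d :
  sigma_subadditive (@lebesgue_outer R d.+1).
Proof.
move=> A; have [[i ioo]|] := pselect (exists i, lebesgue_outer (A i) = +oo).
  rewrite (eseries_pinfty _ _ ioo) ?leey// => n _.
  by rewrite -ltNye (lt_le_trans _ (lebesgue_outer_ge0 _)).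
rewrite -forallNE => Aoo; apply/lee_addgt0Pr => e e0.
rewrite (le_trans _ (epsilon_trick _ _ (ltW e0)))//; last first.
  by move=> n; exact: lebesgue_outer_ge0.
have /choice[G PG] n : exists uv : nat -> 'rV[R]_d.+1 * 'rV[R]_d.+1,
    [/\ forall k i, ((uv k).1 ord0 i <= (uv k).2 ord0 i)%R,
        A n `<=` \bigcup_k open_box (uv k).1 (uv k).2 &
        \sum_(0 <= k <oo) (box_volume (uv k).1 (uv k).2)%:E <=
          lebesgue_outer (A n) + (e / (2 ^ n.+1)%:R)%:E].
  have en : (0 < e / (2 ^ n.+1)%:R)%R by rewrite divr_gt0// ltr0n expn_gt0.
  have fA : lebesgue_outer (A n) \is a fin_num.
    by rewrite ge0_fin_numE ?lebesgue_outer_ge0// ltey; apply/eqP/Aoo.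
  have [_ [u [v [uv Auv ->]]] /ltW lt] := lb_ereal_inf_adherent en fA.
  by exists (fun k => (u k, v k)).
pose vol k := (box_volume (G k.1 k.2).1 (G k.1 k.2).2)%:E.
have vol0 k : 0 <= vol k by rewrite lee_fin box_volume_ge0//; have [] := PG k.1.
have /card_esym/ppcard_eqP[f] := card_nat2.
apply: (@le_trans _ _ (\esum_(k in [set: nat * nat]) vol k)).
  apply: ereal_inf_lbound.
  exists (fun k => (G (f k).1 (f k).2).1), (fun k => (G (f k).1 (f k).2).2).
  split => [k i|x [n _ Anx]|]; first by have [+ _ _] := PG (f k).1; exact.
  - have [_ /(_ _ Anx)[k _ Gx] _] := PG n.
    by exists (f^-1%FUN (n, k)) => //=; rewrite invK ?inE.
  - rewrite (nneseries_esumT (a := vol \o f)).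
      exact: reindex_esum.
    by move=> k; exact: vol0.
have -> : \esum_(k in [set: nat * nat]) vol k =
    \esum_(i in [set: nat]) \esum_(j in [set: nat]) vol (i, j).
  rewrite (esum_esum (a := fun i j => vol (i, j)))//.
  by congr esum; apply/seteqP; split.
rewrite -nneseries_esumT; last by move=> n; exact: esum_ge0.
apply: lee_nneseries => [n _ _|n _]; first exact: esum_ge0.
by rewrite -nneseries_esumT//; have [] := PG n.
Qed.

End OuterMeasure.

HB.instance Definition _ (R : realType) (d : nat) :=
  isOuterMeasure.Build R 'rV[R]_d.+1 (@lebesgue_outer R d.+1)
    (@lebesgue_outer0 R d) (@lebesgue_outer_ge0 R d.+1)
    (@lebesgue_outer_le R d.+1) (@lebesgue_outer_sigma_subadditive R d).

(** * Dyadic cubes and lattice means *)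

Definition dyad {R : realType} (n : nat) : R := 2^-1 ^+ n.

Section DyadicAverages.
Context {R : realType} {d : nat}.
Implicit Types (x y v : 'rV[R]_d) (g : 'rV[R]_d -> R) (b M : R) (e : {ffun 'I_d -> bool}).

Definition corner e : 'rV[R]_d := \row_j (if e j then 1 else 0).

Definition child (n : nat) x e : 'rV[R]_d := x + dyad n.+1 *: corner e.

Definition cube (n : nat) x : set 'rV[R]_d :=
  [set y | forall i, x ord0 i <= y ord0 i < x ord0 i + dyad n].

Definition l1norm v : R := \sum_i `|v ord0 i|.

(** The mean of [g] over the [2^d] dyadic children, each represented by its
    lowest corner, of the cube of side [2^-n] at [x]. *)
Definition child_mean (n : nat) g x : R := dyad d * \sum_e g (child n x e).

(** The mean of [g] over the [2^(m d)] points of the translated lattice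
    [x + 2^-(n + m) Z^d] in [cube n x].  Recursing from the root makes the
    martingale identity hold by computation. *)
Fixpoint cube_avg (m n : nat) g x : R :=
  if m is m'.+1 then child_mean n (cube_avg m' n.+1 g) x else g x.

Lemma dyad_gt0 n : 0 < dyad n :> R. Proof. by rewrite exprn_gt0. Qed.

Lemma dyadS n : dyad n.+1 + dyad n.+1 = dyad n :> R.
Proof. by rewrite /dyad exprS; lra. Qed.

Lemma dyad_le1 n : dyad n <= 1 :> R.
Proof. by rewrite exprn_ile1// invf_le1// ler1n. Qed.

Lemma cube_refl n x : cube n x x.
Proof. by move=> i; rewrite lexx ltrDl dyad_gt0. Qed.

Lemma cube_child n x e y : cube n.+1 (child n x e) y -> cube n x y.
Proof.
move=> xy i; have := xy i; rewrite /child !mxE -(dyadS n).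
have c0 := @dyad_gt0 n.+1; move: c0.
by case: (e i) => /= c0 /andP[? ?]; apply/andP; split; lra.
Qed.

Lemma cube_split n x y : cube n x y -> exists e, cube n.+1 (child n x e) y.
Proof.
move=> xy; exists [ffun i => x ord0 i + dyad n.+1 <= y ord0 i] => i.
have := xy i; rewrite /child !mxE ffunE -(dyadS n).
have c0 := @dyad_gt0 n.+1.
move=> /andP[? ?]; case: (leP (x ord0 i + dyad n.+1) (y ord0 i)) => h;
  by apply/andP; split; lra.
Qed.

Lemma l1norm_cube n x y : cube n x y -> l1norm (y - x) <= d%:R * dyad n.
Proof.
move=> xy; rewrite mulr_natl -[X in _ *+ X]card_ord -sumr_const.
by apply: ler_sum => i _; rewrite !mxE ler_norml; have /andP[? ?] := xy i; apply/andP; split; lra.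
Qed.

Lemma card_corner : dyad d * #|{ffun 'I_d -> bool}|%:R = 1 :> R.
Proof.
by rewrite /dyad card_ffun card_bool card_ord natrX -exprMn mulVf ?expr1n.
Qed.

Lemma child_mean_cst n c x : child_mean n (fun=> c) x = c.
Proof. by rewrite /child_mean sumr_const -[c *+ _]mulr_natl mulrA card_corner mul1r. Qed.

Lemma child_meanB n g g' x : child_mean n (fun y => g y - g' y) x = child_mean n g x - child_mean n g' x.
Proof. by rewrite /child_mean sumrB mulrBr. Qed.

Lemma child_meanZ n c g x : child_mean n (fun y => c * g y) x = c * child_mean n g x.
Proof. by rewrite /child_mean -mulr_sumr mulrCA. Qed.

Lemma child_mean_shift n g v x : child_mean n g (x + v) = child_mean n (fun y => g (y + v)) x.
Proof.
by rewrite /child_mean; congr (_ * _); apply: eq_bigr => e _; rewrite /child addrAC.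
Qed.

Lemma le_child_mean n g g' x : (forall e, g (child n x e) <= g' (child n x e)) ->
  child_mean n g x <= child_mean n g' x.
Proof.
by move=> gg'; apply: ler_wpM2l; [exact/ltW/dyad_gt0|exact: ler_sum].
Qed.

Lemma child_mean_norm_le n g x b : (forall e, `|g (child n x e)| <= b) ->
  `|child_mean n g x| <= b.
Proof.
move=> gb; rewrite ler_norml -{1}(child_mean_cst n (- b) x) -{2}(child_mean_cst n b x).
by apply/andP; split; apply: le_child_mean => e; have := gb e; rewrite ler_norml => /andP[? ?]; lra.
Qed.

Lemma cube_avgB m n g g' x :
  cube_avg m n (fun y => g y - g' y) x = cube_avg m n g x - cube_avg m n g' x.
Proof.
elim: m n x => //= m IH n x; rewrite -child_meanB; congr child_mean.
by apply/funext => y; exact: IH.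
Qed.

Lemma cube_avgZ m n c g x : cube_avg m n (fun y => c * g y) x = c * cube_avg m n g x.
Proof.
elim: m n x => //= m IH n x; rewrite -child_meanZ; congr child_mean.
by apply/funext => y; exact: IH.
Qed.

Lemma cube_avg_shift m n g v x :
  cube_avg m n g (x + v) = cube_avg m n (fun y => g (y + v)) x.
Proof.
elim: m n x => //= m IH n x; rewrite child_mean_shift; congr child_mean.
by apply/funext => y; exact: IH.
Qed.

(** Refining at the leaves rather than at the root; the shift estimate below
    is an induction in this direction. *)
Lemma cube_avg_refine m n g x :
  cube_avg m.+1 n g x = cube_avg m n (child_mean (n + m) g) x.
Proof.
elim: m n x => [|m IH] n x; first by rewrite addn0.
have E : cube_avg m.+1 n.+1 g = cube_avg m n.+1 (child_mean (n + m.+1) g).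
  by apply/funext => y; rewrite IH addSnnS.
by rewrite -[LHS]/(child_mean n (cube_avg m.+1 n.+1 g) x) E.
Qed.

Lemma cube_avg_norm_le m n g c x b : (forall y, cube n x y -> `|g y - c| <= b) ->
  `|cube_avg m n g x - c| <= b.
Proof.
elim: m n x => [|m IH] n x gb /=; first exact/gb/cube_refl.
rewrite -[X in _ - X](child_mean_cst n c x) -child_meanB; apply: child_mean_norm_le => e.
by apply: IH => y /cube_child; exact: gb.
Qed.

Lemma cube_avg_increment_le m n g x v b : (forall y, `|g (y + v) - g y| <= b) ->
  `|cube_avg m n g (x + v) - cube_avg m n g x| <= b.
Proof.
move=> gb; rewrite cube_avg_shift -cube_avgB -[X in `|X|]subr0.
by apply: cube_avg_norm_le => y _; rewrite subr0.
Qed.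

Definition axis (j : 'I_d) : 'rV[R]_d := delta_mx ord0 j.

Definition flip (j : 'I_d) e : {ffun 'I_d -> bool} :=
  [ffun i => if i == j then ~~ e i else e i].

Lemma flipK j : involutive (flip j).
Proof. by move=> e; apply/ffunP => i; rewrite !ffunE; case: eqP => //; rewrite negbK. Qed.

Lemma sum_corner_flip (j : 'I_d) (F : {ffun 'I_d -> bool} -> R) :
  \sum_e F e = \sum_(e : {ffun 'I_d -> bool} | ~~ e j) (F e + F (flip j e)).
Proof.
rewrite (bigID (fun e : {ffun 'I_d -> bool} => e j)) /= addrC big_split /=; congr (_ + _).
rewrite (reindex_inj (inv_inj (flipK j))) /=; apply: eq_bigl => e.
by rewrite ffunE eqxx.
Qed.

Lemma corner_flip j e : ~~ e j -> corner (flip j e) = corner e + axis j.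
Proof.
move=> /negbTE ej; apply/rowP => i; rewrite !mxE ffunE eqxx /=.
by case: eqP => [->|]; rewrite ?ej ?addr0 ?add0r.
Qed.

(** The mean over the children on the lower face orthogonal to axis [j]; it is
    normalised by [2^(d - 1)]. *)
Definition face_mean n (j : 'I_d) g x : R :=
  dyad d * 2 * \sum_(e : {ffun 'I_d -> bool} | ~~ e j) g (child n x e).

Lemma face_mean_increment n j g x v b : (forall y, `|g (y + v) - g y| <= b) ->
  `|face_mean n j g (x + v) - face_mean n j g x| <= b.
Proof.
move=> gb; rewrite /face_mean -mulrBr -sumrB normrM ger0_norm; last first.
  by rewrite mulr_ge0// ltW// dyad_gt0.
apply: (@le_trans _ _ (dyad d * 2 * \sum_(e : {ffun 'I_d -> bool} | ~~ e j) b)).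
  apply: ler_wpM2l; first by rewrite mulr_ge0// ltW// dyad_gt0.
  apply: le_trans (ler_norm_sum _ _ _) _; apply: ler_sum => e _.
  by rewrite /child addrAC.
rewrite -mulrA mulr_sumr.
under eq_bigr => e _ do rewrite mulrDl mul1r.
by rewrite -(sum_corner_flip j (fun=> b)) -/(child_mean 0 (fun=> b) x) child_mean_cst.
Qed.

(** Telescoping: a shift by half the side moves the lower half of the children
    onto the upper half, so only the two extreme faces remain, at distance
    [dyad n]. *)
Lemma child_mean_increment n j g x :
  child_mean n g (x + dyad n.+1 *: axis j) - child_mean n g x =
  2^-1 * (face_mean n j g (x + dyad n *: axis j) - face_mean n j g x).
Proof.
have E a : child_mean n g a = dyad d * \sum_(e : {ffun 'I_d -> bool} | ~~ e j)
    (g (child n a e) + g (child n (a + dyad n.+1 *: axis j) e)).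
  rewrite /child_mean (sum_corner_flip j); congr (_ * _); apply: eq_bigr => e ej.
  by rewrite /child corner_flip// scalerDr addrAC addrA.
have -> : x + dyad n *: axis j = x + dyad n.+1 *: axis j + dyad n.+1 *: axis j.
  by rewrite -addrA -scalerDl dyadS.
have half2 (c : R) : 2^-1 * (dyad d * 2 * c) = dyad d * c by field.
rewrite !E /face_mean -!mulrBr half2 -!sumrB; congr (_ * _).
by apply: eq_bigr => e _; ring.
Qed.

(** Each of the [m] levels gains a factor 2 from [child_mean_increment], and
    leaves a function of the same kind, whose increments at distance [dyad n] are still
    bounded by [b]. *)
Lemma cube_avg_increment_dyad m n g j b x :
  (forall y, `|g (y + dyad n *: axis j) - g y| <= b) ->
  `|cube_avg m n g (x + dyad (n + m) *: axis j) - cube_avg m n g x| <= dyad m * b.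
Proof.
elim: m g => [|m IH] g gb; first by rewrite addn0 /dyad expr0 mul1r; exact: gb.
rewrite !cube_avg_refine addnS cube_avg_shift -cube_avgB.
under [fun y => _ - _]eq_fun do rewrite child_mean_increment.
rewrite cube_avgZ cube_avgB -cube_avg_shift normrM ger0_norm// [dyad m.+1]exprS -mulrA.
rewrite ler_pM2l//; apply: IH => y.
exact: face_mean_increment.
Qed.

End DyadicAverages.

(** * Near-invariance of lattice means under translations *)

Section HolderShift.
Context {R : realType} {d : nat}.
Implicit Types (x y v : 'rV[R]_d) (g : 'rV[R]_d -> R) (b M : R).

(** Uniform Hoelder continuity for the [l^1] norm, which adds up over the
    coordinates. *)
Definition holder (M alpha : R) g :=
  forall x v, `|g (x + v) - g x| <= M * l1norm v `^ alpha.

Lemma l1norm_ge0 v : 0 <= l1norm v.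
Proof. by apply: sumr_ge0 => i _; exact: normr_ge0. Qed.

Lemma l1normZ c v : l1norm (c *: v) = `|c| * l1norm v.
Proof. by rewrite /l1norm mulr_sumr; apply: eq_bigr => i _; rewrite mxE normrM. Qed.

Lemma l1norm_axis j : l1norm (axis j : 'rV[R]_d) = 1.
Proof.
rewrite /l1norm (bigD1 j) //= mxE !eqxx normr1 big1 ?addr0// => i ij.
by rewrite mxE (negbTE ij) andbF normr0.
Qed.

Lemma euclidean_norm_le_l1norm v : euclidean_norm v <= l1norm v.
Proof.
rewrite -(ger0_norm (l1norm_ge0 v)) -sqrtr_sqr ler_wsqrtr// expr2 /l1norm mulr_suml.
apply: ler_sum => i _; rewrite -real_normK ?num_real// expr2 ler_wpM2l//.
by rewrite (bigD1 i)//= lerDl sumr_ge0.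
Qed.

Lemma holder_of_norm alpha f M : 0 < alpha ->
  holder_norm alpha f = M%:E -> holder `|M| alpha f.
Proof.
move=> alpha0 fM x v; have [->|v0] := eqVneq v 0.
  by rewrite addr0 subrr normr0 mulr_ge0// powR_ge0.
have e0 : 0 < euclidean_norm v.
  rewrite sqrtr_gt0 lt_neqAle sumr_ge0 ?andbT; last by move=> i _; exact: sqr_ge0.
  apply: contra v0; rewrite eq_sym psumr_eq0 => [/allP v0|i _]; last exact: sqr_ge0.
  apply/eqP/rowP => i; rewrite mxE; apply/eqP; rewrite -sqrf_eq0.
  by apply: v0; rewrite mem_index_enum.
have : ((`|f (x + v) - f x| / euclidean_norm v `^ alpha)%:E <= M%:E)%E.
  by rewrite -fM; apply: ereal_sup_ubound; exists x, v.
rewrite lee_fin ler_pdivrMr ?powR_gt0// => /le_trans; apply.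
apply: (@le_trans _ _ (`|M| * euclidean_norm v `^ alpha)).
  by rewrite ler_wpM2r ?powR_ge0 ?ler_norm.
rewrite ler_wpM2l// ge0_ler_powR ?nnegrE ?sqrtr_ge0 ?l1norm_ge0 ?(ltW alpha0)//.
exact: euclidean_norm_le_l1norm.
Qed.

Lemma holder_cube_avg M alpha g m n :
  holder M alpha g -> holder M alpha (cube_avg m n g).
Proof. by move=> gM x v; apply: cube_avg_increment_le => y; exact: gM. Qed.

Lemma dyadD n m : dyad (n + m) = dyad n * dyad m :> R.
Proof. exact: exprD. Qed.

Lemma cube_avg_increment_multiple m n g j (b : R) s x :
  (forall y, `|g (y + dyad n *: axis j) - g y| <= b) ->
  `|cube_avg m n g (x + (s%:R * dyad (n + m)) *: axis j) - cube_avg m n g x| <=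
  s%:R * (dyad m * b).
Proof.
move=> gb; elim: s => [|s IH]; first by rewrite !mul0r scale0r addr0 subrr normr0.
rewrite -natr1 !mulrDl !mul1r scalerDl addrA.
apply: le_trans (ler_distD (cube_avg m n g (x + (s%:R * dyad (n + m)) *: axis j)) _ _) _.
by rewrite [leRHS]addrC lerD//; exact: cube_avg_increment_dyad.
Qed.

(** The shift [t] is rounded down to a multiple of the lattice step; the
    remainder costs one increment of [g] at the finest scale. *)
Lemma cube_avg_increment_axis M alpha m n g j t x : 0 <= M -> 0 <= alpha ->
  holder M alpha g ->
  `|cube_avg m n g (x + t *: axis j) - cube_avg m n g x| <=
  `|t| * (M * dyad n `^ alpha / dyad n) + M * dyad (n + m) `^ alpha.
Proof.
move=> M0 alpha0 gM.
have axis_increment c y : 0 <= c -> `|g (y + c *: axis j) - g y| <= M * c `^ alpha.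
  by move=> c0; have := gM y (c *: axis j); rewrite l1normZ l1norm_axis mulr1 (ger0_norm c0).
wlog t0 : t x / 0 <= t => [wlog_t|].
  have [|t0] := leP 0 t; first exact: wlog_t.
  have := wlog_t (- t) (x + t *: axis j).
  rewrite -addrA -scalerDl subrr scale0r addr0 normrN distrC; apply.
  by rewrite oppr_ge0 ltW.
have D0 := @dyad_gt0 R (n + m); set D := dyad (n + m) in D0 *.
set s := Num.truncn (t / D).
have /andP[sD Ds] : s%:R <= t / D < s.+1%:R.
  by apply: truncn_itv; rewrite divr_ge0// ltW.
have {}sD : s%:R * D <= t by rewrite -ler_pdivlMr.
have {}Ds : t - s%:R * D <= D.
  by rewrite lerBlDl -{2}[D]mul1r -mulrDl natr1 -ler_pdivrMr//; exact: ltW.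
have -> : t *: axis j = (t - s%:R * D) *: axis j + (s%:R * D) *: axis j.
  by rewrite -scalerDl subrK.
rewrite addrA (ger0_norm t0).
apply: le_trans (ler_distD (cube_avg m n g (x + (t - s%:R * D) *: axis j)) _ _) _.
apply: lerD; last first.
  apply: cube_avg_increment_le => y; apply: le_trans (axis_increment _ _ _) _.
    by rewrite subr_ge0.
  by rewrite ler_wpM2l// ge0_ler_powR ?nnegrE ?subr_ge0 ?(ltW D0).
apply: le_trans (cube_avg_increment_multiple _ _ _ (b := M * dyad n `^ alpha) _) _.
  by move=> y; apply: axis_increment; rewrite ltW ?dyad_gt0.
rewrite [leRHS]mulrA mulrAC mulrA ler_wpM2r ?mulr_ge0 ?powR_ge0//.
by rewrite ler_pdivlMr ?dyad_gt0// -mulrA [dyad m * _]mulrC -dyadD.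
Qed.

(** The gain over plain Hoelder continuity is that the first term is linear in
    [l1norm v]: it is summable over the scales below [dyad n]. *)
Lemma cube_avg_increment_vector M alpha m n g v x : 0 <= M -> 0 <= alpha ->
  holder M alpha g ->
  `|cube_avg m n g (x + v) - cube_avg m n g x| <=
  l1norm v * (M * dyad n `^ alpha / dyad n) + d%:R * (M * dyad (n + m) `^ alpha).
Proof.
move=> M0 alpha0 gM.
rewrite {1}[v]row_sum_delta /l1norm mulr_suml -[d in d%:R]card_ord mulr_natl -sumr_const.
rewrite -big_split /=.
elim: (index_enum 'I_d) => [|j s IH]; first by rewrite !big_nil addr0 subrr normr0.
rewrite !big_cons [_ *: _ + _]addrC addrA.
apply: le_trans (ler_distD (cube_avg m n g (x + \sum_(i <- s) v ord0 i *: axis i)) _ _) _.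
by apply: lerD => //; exact: cube_avg_increment_axis.
Qed.

End HolderShift.

(** * Integrals over a range of scales *)

Section WindowIntegral.
Context {R : realType} {d p : nat}.
Context (alpha : R) (a : 'I_p -> 'rV[R]_d) (mu : 'I_p -> R).
Implicit Types (x y v : 'rV[R]_d) (phi : 'rV[R]_d -> R) (s t h M b : R).
Context (alpha_gt0 : 0 < alpha).

Definition window_integrand phi x h : R :=
  (\sum_(i < p) mu i * phi (x + h *: a i)) / (h `^ alpha) / h.

(** The part of [Gamma] that comes from [s <= h <= t]. *)
Definition window s t phi x : R :=
  (\int[lebesgue_measure]_(h in `[s, t]) window_integrand phi x h)%R.

Lemma GammaE f eps x : Gamma alpha a mu f eps x = window eps 1 f x.
Proof. by []. Qed.

Lemma holder_line_continuous M phi x v : 0 <= M -> holder M alpha phi ->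
  continuous (fun h : R => phi (x + h *: v)).
Proof.
move=> M0 phiM h; apply/cvgrPdist_le => /= e e0.
have A0 : 0 < l1norm v + 1 by rewrite ltr_wpDl ?l1norm_ge0.
have M1 : 0 < M + 1 by rewrite ltr_wpDl.
have r0 : 0 < (e / (M + 1)) `^ alpha^-1 / (l1norm v + 1).
  by apply: divr_gt0 => //; apply: powR_gt0; exact: divr_gt0.
near=> k.
have : `|h - k| <= (e / (M + 1)) `^ alpha^-1 / (l1norm v + 1).
  near: k; apply/nbhs_ballP; exists ((e / (M + 1)) `^ alpha^-1 / (l1norm v + 1)) => //.
  by move=> k; exact: ltW.
rewrite ler_pdivlMr// => hk.
have -> : x + h *: v = x + k *: v + (h - k) *: v.
  by rewrite -addrA -scalerDl addrCA subrr addr0.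
apply: le_trans (phiM _ _) _; rewrite l1normZ.
apply: (@le_trans _ _ (M * (e / (M + 1)))).
  have E : ((e / (M + 1)) `^ alpha^-1) `^ alpha = e / (M + 1).
    by rewrite -powRrM mulVf ?lt0r_neq0// powRr1// ltW// divr_gt0.
  rewrite ler_wpM2l// -[leRHS]E.
  apply: ge0_ler_powR; rewrite ?nnegrE ?mulr_ge0 ?l1norm_ge0 ?powR_ge0 ?(ltW alpha_gt0)//.
  by apply: le_trans hk; rewrite ler_wpM2l// lerDl.
by rewrite mulrCA ler_piMr ?ltW// ltr_pdivrMr// mul1r ltrDl.
Unshelve. all: by end_near. Qed.

Lemma window_integrand_integrable M phi x s t : 0 < s -> 0 <= M ->
  holder M alpha phi ->
  lebesgue_measure.-integrable `[s, t] (EFin \o window_integrand phi x).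
Proof.
move=> s0 M0 phiM; apply: continuous_compact_integrable; first exact: segment_compact.
apply: continuous_in_subspaceT => h; rewrite inE /= in_itv /= => /andP[sh _].
have h0 : 0 < h := lt_le_trans s0 sh.
apply: cvgM; last by apply: cvgV; [rewrite gt_eqF|exact: cvg_id].
apply: cvgM; last first.
  apply: cvgV; first by rewrite gt_eqF// powR_gt0.
  have : {for h, continuous (fun k : R => k `^ alpha)}.
    apply: differentiable_continuous; apply/derivable1_diffP.
    by apply: derivable_powR; rewrite in_itv /= h0.
  exact.
apply: cvg_big => // [|i _]; first exact: add_continuous.
apply: cvgM; first exact: cvg_cst.
exact: (holder_line_continuous M0 phiM).
Qed.

Lemma Rintegral_sum (I : Type) (r : seq I) (D : set R) (F : I -> R -> R) :
  measurable D ->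
  (forall i, lebesgue_measure.-integrable D (EFin \o F i)) ->
  (\int[lebesgue_measure]_(h in D) \sum_(i <- r) F i h)%R =
  \sum_(i <- r) (\int[lebesgue_measure]_(h in D) F i h)%R.
Proof.
move=> mD iF; elim: r => [|i r IH].
  under eq_Rintegral => h _ do rewrite big_nil.
  by rewrite Rintegral_cst// mul0r big_nil.
under eq_Rintegral => h _ do rewrite big_cons.
rewrite RintegralD// ?IH ?big_cons//.
have -> : EFin \o (fun h => \sum_(i <- r) F i h) =
    (fun h => \sum_(i <- r) (EFin \o F i) h)%E.
  by apply/funext => h /=; rewrite sumEFin.
by apply: integrable_sum => // k _; exact: iF.
Qed.

Lemma window_split M phi x s t u : 0 < s -> s <= t -> t <= u -> 0 <= M ->
  holder M alpha phi -> window s u phi x = window s t phi x + window t u phi x.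
Proof.
move=> s0 st tu M0 phiM; have t0 : 0 < t := lt_le_trans s0 st.
apply/eqP; rewrite addrC -subr_eq; apply/eqP.
rewrite /window Rintegral_itvB ?bnd_simp//; last first.
  exact: window_integrand_integrable phiM.
rewrite Rintegral_itv_obnd_cbnd//.
apply: integrableS (window_integrand_integrable x u t0 M0 phiM) => //.
exact: subset_itv_oc_cc.
Qed.

Lemma windowB M phi psi x s t : 0 < s -> 0 <= M ->
  holder M alpha phi -> holder M alpha psi ->
  window s t (fun y => phi y - psi y) x = window s t phi x - window s t psi x.
Proof.
move=> s0 M0 phiM psiM; rewrite /window -RintegralB//; last 2 first.
- exact: window_integrand_integrable phiM.
- exact: window_integrand_integrable psiM.
apply: eq_Rintegral => h _; rewrite /window_integrand -!mulrBl; congr (_ / _ / _).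
by rewrite -sumrB; apply: eq_bigr => i _; rewrite mulrBr.
Qed.

Lemma window_child_mean M n phi x s t : 0 < s -> 0 <= M -> holder M alpha phi ->
  window s t (child_mean n phi) x = child_mean n (window s t phi) x.
Proof.
move=> s0 M0 phiM; rewrite /child_mean /window -Rintegral_sum//; last first.
  by move=> e; exact: window_integrand_integrable phiM.
rewrite -RintegralZl//; last first.
  have -> : EFin \o (fun h => \sum_e window_integrand phi (child n x e) h) =
      (fun h => \sum_e (EFin \o window_integrand phi (child n x e)) h)%E.
    by apply/funext => h /=; rewrite sumEFin.
  by apply: integrable_sum => // e _; exact: window_integrand_integrable phiM.
apply: eq_Rintegral => h _; rewrite /window_integrand -!mulr_suml !mulrA.
congr (_ / _ / _); rewrite exchange_big mulr_sumr; apply: eq_bigr => i _.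
rewrite -mulr_sumr mulrCA; congr (_ * (_ * _)); apply: eq_bigr => e _.
by rewrite /child addrAC.
Qed.

Lemma window_cube_avg M m n phi x s t : 0 < s -> 0 <= M -> holder M alpha phi ->
  window s t (cube_avg m n phi) x = cube_avg m n (window s t phi) x.
Proof.
move=> s0 M0 phiM; elim: m n x => //= m IH n x.
rewrite (@window_child_mean M)//; last exact: holder_cube_avg.
by congr child_mean; apply/funext => y; exact: IH.
Qed.

(** The weight [h^-(alpha+1)] has mass at most [s^-alpha] on a range of [h]
    whose endpoints differ by a factor at most 2. *)
Lemma window_norm_le M phi x s t b : 0 < s -> s <= t -> t <= s + s -> 0 <= M ->
  holder M alpha phi ->
  (forall h, s <= h <= t -> `|\sum_i mu i * phi (x + h *: a i)| <= b) ->
  `|window s t phi x| <= b / s `^ alpha.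
Proof.
move=> s0 st ts M0 phiM phib.
have b0 : 0 <= b by apply: le_trans (phib s _); rewrite ?normr_ge0// lexx st.
have int_phi := window_integrand_integrable x t s0 M0 phiM.
apply: le_trans (le_normr_Rintegral _ int_phi) _ => //.
have cst_int : lebesgue_measure.-integrable `[s, t] (EFin \o cst (b / s `^ alpha / s)).
  apply: continuous_compact_integrable; first exact: segment_compact.
  by apply: continuous_subspaceT => h; exact: cst_continuous.
apply: (@le_trans _ _ (\int[lebesgue_measure]_(h in `[s, t]) (b / s `^ alpha / s))%R).
  apply: le_Rintegral => //; first exact: integrable_norm int_phi.
  move=> h; rewrite /= in_itv /= => sht; have /andP[sh ht] := sht.
  have h0 : 0 < h := lt_le_trans s0 sh.
  rewrite /window_integrand !normrM !normfV (ger0_norm (ltW h0)).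
  rewrite (ger0_norm (powR_ge0 _ _)) -!mulrA; apply: ler_pM => //.
  - by rewrite mulr_ge0// invr_ge0 ?powR_ge0// ltW.
  - exact: phib.
  apply: ler_pM; rewrite ?invr_ge0 ?powR_ge0 ?(ltW h0)//.
    rewrite lef_pV2 ?posrE ?powR_gt0//.
    by rewrite ge0_ler_powR ?nnegrE// ltW.
  by rewrite lef_pV2 ?posrE.
rewrite Rintegral_cst//= lebesgue_measure_itv/= lte_fin; case: ifP => _ /=; last first.
  by rewrite mulr0 divr_ge0// powR_ge0.
apply: (@le_trans _ _ (b / s `^ alpha / s * s)); last by rewrite divfK// gt_eqF.
by rewrite ler_wpM2l ?divr_ge0 ?powR_ge0 ?(ltW s0)// lerBlDr.
Qed.

End WindowIntegral.

(** * Gamma as an almost-martingale *)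

Section ScaleDecay.
Context {R : realType} (alpha : R) (alpha_gt0 : 0 < alpha) (alpha_lt1 : alpha < 1).

(** The ratio of [h ^ alpha] between consecutive dyadic scales.  It lies
    strictly between [1/2] and [1], and both geometric series of the
    martingale approximation converge because of that. *)
Definition decay : R := 2^-1 `^ alpha.

Lemma powR_half_lt1 (b : R) : 0 < b -> 2^-1 `^ b < 1.
Proof.
move=> b0; have := @gt0_ltr_powR R b b0 2^-1 1; rewrite powR1; apply.
- by rewrite nnegrE.
- by rewrite nnegrE.
- by rewrite invf_lt1 ?ltr1n.
Qed.

Lemma decay_gt0 : 0 < decay. Proof. exact: powR_gt0. Qed.

Lemma decay_lt1 : decay < 1.
Proof.
by apply: powR_half_lt1.
Qed.

Lemma decay_gt_half : 2^-1 < decay.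
Proof.
have c_lt1 : 2^-1 `^ (1 - alpha) < 1 :> R.
  by apply: powR_half_lt1; rewrite subr_gt0.
have {1}-> : 2^-1 = decay * 2^-1 `^ (1 - alpha) :> R.
  rewrite /decay -powRD; last by apply/implyP => _; rewrite invr_eq0 pnatr_eq0.
  have -> : alpha + (1 - alpha) = 1 by ring.
  by rewrite powRr1.
by rewrite gtr_pMr ?decay_gt0.
Qed.

Lemma powR_dyad n : dyad n `^ alpha = decay ^+ n.
Proof.
elim: n => [|n IH]; first by rewrite /dyad !expr0 powR1.
by rewrite /dyad exprS powRM ?exprn_ge0// IH exprS.
Qed.

End ScaleDecay.

(** A bound for the distance from [F_n] to its martingale approximation: two
    sums of geometric series over the scales finer than [n], and the oscillation
    of [F_n] on a cube of side [2^-n]. *)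
Definition defect {R : realType} (d : nat) (alpha A w : R) : R :=
  w * (A / (decay alpha - 2^-1) + d%:R / (1 - decay alpha)) +
  w * (d.+1%:R / (1 - decay alpha)).

Section AlmostMartingale.
Context {R : realType} {d p : nat}.
Context (alpha : R) (a : 'I_p -> 'rV[R]_d) (mu : 'I_p -> R).
Context (f : 'rV[R]_d -> R) (M A : R).
Context (alpha_gt0 : 0 < alpha) (alpha_lt1 : alpha < 1).
Context (mu_sum0 : \sum_i mu i = 0).
Context (M_ge0 : 0 <= M) (f_holder : holder M alpha f).
Context (A_ge1 : 1 <= A) (a_le : forall i, l1norm (a i) <= A).
Implicit Types (x y v : 'rV[R]_d) (phi : 'rV[R]_d -> R) (s t h b : R).

Local Notation q := (decay alpha).
Local Notation W := ((\sum_i `|mu i|) * M).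
Let q_gt0 : 0 < q := decay_gt0 alpha.
Let q_lt1 : q < 1 := decay_lt1 alpha_gt0.
Let q_gt_half : 2^-1 < q := decay_gt_half alpha_lt1.

Let mu_ge0 : 0 <= \sum_i `|mu i|. Proof. by rewrite sumr_ge0. Qed.
Let W_ge0 : 0 <= W. Proof. by rewrite mulr_ge0. Qed.

(** The only place where the weights cancel: [c] is arbitrary because they sum
    to zero. *)
Lemma weighted_sum_le (g : 'I_p -> R) c b : (forall i, `|g i - c| <= b) ->
  `|\sum_i mu i * g i| <= (\sum_i `|mu i|) * b.
Proof.
move=> gb; have -> : \sum_i mu i * g i = \sum_i mu i * (g i - c).
  under [RHS]eq_bigr do rewrite mulrBr.
  by rewrite sumrB -mulr_suml mu_sum0 mul0r subr0.
apply: le_trans (ler_norm_sum _ _ _) _; rewrite mulr_suml; apply: ler_sum => i _.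
by rewrite normrM ler_wpM2l.
Qed.

Lemma window_bounded s t x : 0 < s -> s <= t -> t <= s + s ->
  `|window alpha a mu s t f x| <= W * (A *+ 2).
Proof.
move=> s0 st ts; have A0 : 0 <= A by apply: le_trans A_ge1.
have -> : W * (A *+ 2) = W * (A *+ 2) * s `^ alpha / s `^ alpha.
  by rewrite mulfK// gt_eqF// powR_gt0.
apply: (@window_norm_le _ _ _ _ _ _ alpha_gt0 M) => // h /andP[sh ht].
rewrite -2![in leRHS]mulrA; apply: (@weighted_sum_le _ (f x)) => i.
apply: le_trans (f_holder _ _) _; rewrite ler_wpM2l// l1normZ.
have h0 : 0 < h := lt_le_trans s0 sh.
rewrite gtr0_norm//; apply: (@le_trans _ _ ((A *+ 2 * s) `^ alpha)).
  apply: ge0_ler_powR; rewrite ?nnegrE ?mulr_ge0 ?l1norm_ge0 ?mulrn_wge0 //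
    ?(ltW alpha_gt0) ?(ltW h0) ?(ltW s0)//.
  apply: (@le_trans _ _ ((s + s) * A)); last by rewrite mulrnAl -mulrnAr mulr2n mulrC.
  by apply: ler_pM => //; rewrite ?l1norm_ge0 ?(le_trans ht)// ltW.
rewrite powRM ?mulrn_wge0 ?(ltW s0)// ler_wpM2r ?powR_ge0// ler1_powR// ?(ltW alpha_lt1)//.
by rewrite (le_trans A_ge1)// mulr2n lerDl.
Qed.

Lemma window_increment s t x v : 0 < s -> s <= t -> t <= s + s ->
  `|window alpha a mu s t f (x + v) - window alpha a mu s t f x| <=
  W * l1norm v `^ alpha / s `^ alpha.
Proof.
move=> s0 st ts; pose fv y := f (y + v).
have fv_holder : holder M alpha fv by move=> y w; rewrite /fv addrAC.
have -> : window alpha a mu s t f (x + v) = window alpha a mu s t fv x.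
  apply: eq_Rintegral => h _; rewrite /window_integrand; congr (_ / _ / _).
  by apply: eq_bigr => i _; rewrite /fv addrAC.
rewrite -(@windowB _ _ _ alpha a mu alpha_gt0 M)//.
have M2 : holder (M + M) alpha (fun y => fv y - f y).
  move=> y w; rewrite mulrDl.
  have -> : fv (y + w) - f (y + w) - (fv y - f y) =
    (fv (y + w) - fv y) - (f (y + w) - f y) by ring.
  by apply: le_trans (ler_normB _ _) _; apply: lerD.
apply: (@window_norm_le _ _ _ _ _ _ alpha_gt0 (M + M)) => //; first exact: addr_ge0.
move=> h _; rewrite -mulrA; apply: (@weighted_sum_le _ 0) => i.
by rewrite subr0 /fv; exact: f_holder.
Qed.

(** Averaging commutes with the integral over [h], and the averaged function
    is nearly constant over the displacements [h *: a i] at scale [k]. *)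
Lemma cube_avg_window m n k x : (n <= k)%N -> (k < n + m)%N ->
  `|cube_avg m n (window alpha a mu (dyad k.+1) (dyad k) f) x| <=
  W * (A / q * (2^-1 / q) ^+ (k - n) + d%:R * q ^+ (n + m - k.+1)).
Proof.
move=> nk km; rewrite -(@window_cube_avg _ _ _ alpha a mu alpha_gt0 M)// ?dyad_gt0//.
have A0 : 0 <= A by apply: le_trans A_ge1.
set b := (X in _ <= _ * X).
have -> : W * b = W * b * dyad k.+1 `^ alpha / dyad k.+1 `^ alpha.
  by rewrite mulfK// gt_eqF// powR_gt0// dyad_gt0.
have gM := holder_cube_avg m n f_holder.
apply: (@window_norm_le _ _ _ _ _ _ alpha_gt0 M) => //.
- exact: dyad_gt0.
- by rewrite -(dyadS k) lerDl ltW// dyad_gt0.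
- by rewrite dyadS.
move=> h /andP[kh hk]; rewrite -2![in leRHS]mulrA.
apply: (@weighted_sum_le _ (cube_avg m n f x)) => i.
apply: le_trans (cube_avg_increment_vector m n (h *: a i) x M_ge0 (ltW alpha_gt0) f_holder) _.
have h0 : 0 < h by apply: lt_le_trans kh; exact: dyad_gt0.
rewrite !powR_dyad l1normZ gtr0_norm//.
apply: (@le_trans _ _ (dyad k * A * (M * q ^+ n / dyad n) + d%:R * (M * q ^+ (n + m)))).
  rewrite lerD2r ler_wpM2r ?ler_pM ?l1norm_ge0 ?(ltW h0)//.
  by rewrite !mulr_ge0 ?invr_ge0 ?exprn_ge0 ?(ltW q_gt0).
rewrite /b; set i' := (k - n)%N; set j := (n + m - k.+1)%N.
have -> : k = (n + i')%N by rewrite subnKC.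
have -> : (n + m)%N = ((n + i').+1 + j)%N by rewrite /j /i' subnKC// subnKC.
rewrite dyadD exprD exprS exprD expr_div_n -/(dyad i') !mulrDl mulrDr.
rewrite le_eqVlt; apply/orP; left; apply/eqP.
have D0 : dyad n != 0 :> R by rewrite gt_eqF// dyad_gt0.
have Q0 k' : q ^+ k' != 0 by rewrite gt_eqF// exprn_gt0.
by have := Q0 i'; have := Q0 1; rewrite expr1 => ? ?; field; do ?[apply/andP; split].
Qed.

Local Notation F n := (window alpha a mu (dyad n) 1 f).

Lemma window_dyadS n x : F n.+1 x = window alpha a mu (dyad n.+1) (dyad n) f x + F n x.
Proof.
apply: (@window_split _ _ _ _ _ _ alpha_gt0 M) => //; first exact: dyad_gt0.
  by rewrite -(dyadS n) lerDl ltW// dyad_gt0.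
exact: dyad_le1.
Qed.

Lemma window_dyad0 x : F 0 x = 0.
Proof. by rewrite /window /dyad expr0 set_itv1 Rintegral_set1. Qed.

(** The finest scale dominates: the bounds for the scales [0, ..., n-1] form a
    geometric series of ratio [decay]. *)
Lemma Gamma_dyad_increment n x v :
  `|F n (x + v) - F n x| <= W * l1norm v `^ alpha / q ^+ n / (1 - q).
Proof.
have q1 : 0 < 1 - q by rewrite subr_gt0.
elim: n => [|n IH].
  rewrite !window_dyad0 subrr normr0 expr0 divr1.
  by rewrite divr_ge0 ?(ltW q1)// (mulr_ge0 W_ge0)// powR_ge0.
rewrite !window_dyadS opprD addrACA; apply: le_trans (ler_normD _ _) _.
have n1n : dyad n.+1 <= dyad n :> R by rewrite -(dyadS n) lerDl ltW// dyad_gt0.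
have := window_increment x v (dyad_gt0 n.+1) n1n; rewrite (dyadS n) lexx => /(_ isT).
move=> /lerD/(_ IH) /le_trans; apply; rewrite powR_dyad exprS.
rewrite le_eqVlt; apply/orP; left; apply/eqP; have := exprn_gt0 n q_gt0.
by move=> /lt0r_neq0 Q0; field; rewrite Q0 !gt_eqF.
Qed.

Lemma Gamma_dyad_cube n x y : cube n x y ->
  `|F n y - F n x| <= W * (d.+1%:R / (1 - q)).
Proof.
move=> /l1norm_cube xy; have q1 : 0 < 1 - q by rewrite subr_gt0.
have {1}-> : y = x + (y - x) by rewrite addrC subrK.
apply: le_trans (Gamma_dyad_increment _ _ _) _.
rewrite [leRHS]mulrA ler_pM2r ?invr_gt0// ler_pdivrMr ?exprn_gt0//.
rewrite -[leRHS]mulrA ler_wpM2l//.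
apply: (@le_trans _ _ ((d.+1%:R * dyad n) `^ alpha)).
  rewrite ge0_ler_powR ?nnegrE ?l1norm_ge0 ?mulr_ge0 ?(ltW alpha_gt0) ?(ltW (dyad_gt0 _))//.
  by apply: le_trans xy _; rewrite ler_wpM2r ?ler_nat ?(ltW (dyad_gt0 _)).
rewrite powRM ?(ltW (dyad_gt0 _))// powR_dyad ler_wpM2r ?exprn_ge0 ?(ltW q_gt0)//.
by rewrite ler1_powR ?ler1n ?(ltW alpha_lt1).
Qed.

Lemma oscillation_le_defect : W * (d.+1%:R / (1 - q)) <= defect d alpha A W.
Proof.
have A0 : 0 <= A by apply: le_trans A_ge1.
have q1 : 0 <= 1 - q by rewrite subr_ge0 ltW.
have q2 : 0 <= q - 2^-1 by rewrite subr_ge0 ltW.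
by rewrite lerDr mulr_ge0// addr_ge0 ?divr_ge0.
Qed.

(** The scales [k] from [n] to [n + m - 1] contribute one series decreasing in
    [k - n] and one decreasing in [n + m - k]. *)
Lemma cube_avg_Gamma_dyad m n x :
  `|cube_avg m n (F (n + m)) x - F n x| <= defect d alpha A W.
Proof.
have q1 : 0 < 1 - q by rewrite subr_gt0.
have q2 : 0 < q - 2^-1 by rewrite subr_gt0.
have A0 : 0 <= A by apply: le_trans A_ge1.
have base : `|cube_avg m n (F n) x - F n x| <= W * (d.+1%:R / (1 - q)).
  by apply: cube_avg_norm_le => y; exact: Gamma_dyad_cube.
apply: le_trans (ler_distD (cube_avg m n (F n) x) _ _) _; apply: lerD => //.
have r_ge0 : 0 <= 2^-1 / q by rewrite divr_ge0// ltW.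
suff H i : (i <= m)%N -> `|cube_avg m n (F (n + i)) x - cube_avg m n (F n) x| <=
    W * (A / (q - 2^-1) * (1 - (2^-1 / q) ^+ i) + d%:R * q ^+ (m - i) / (1 - q)).
  apply: le_trans (H m (leqnn m)) _; rewrite subnn expr0 mulr1 ler_wpM2l// lerD2r.
  by rewrite ler_piMr ?divr_ge0 ?(ltW q2)// lerBlDr lerDl exprn_ge0.
elim: i => [_|i IH im].
  rewrite addn0 subrr normr0 mulr_ge0// expr0 subrr mulr0 add0r.
  by rewrite !mulr_ge0 ?invr_ge0 ?exprn_ge0 ?(ltW q1) ?(ltW q_gt0).
have -> : F (n + i.+1) = fun y => window alpha a mu (dyad (n + i).+1) (dyad (n + i)) f y
    - (- F (n + i) y).
  by apply/funext => y; rewrite addnS window_dyadS opprK.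
have -> : cube_avg m n (fun y => window alpha a mu (dyad (n + i).+1) (dyad (n + i)) f y
    - (- F (n + i) y)) x - cube_avg m n (F n) x =
  cube_avg m n (window alpha a mu (dyad (n + i).+1) (dyad (n + i)) f) x +
  (cube_avg m n (F (n + i)) x - cube_avg m n (F n) x).
  rewrite cube_avgB; have -> : (fun y => - F (n + i) y) = (fun y => -1 * F (n + i) y).
    by apply/funext => y; rewrite mulN1r.
  by rewrite cube_avgZ mulN1r opprK addrA.
apply: le_trans (ler_normD _ _) _.
have := @cube_avg_window m n (n + i) x (leq_addr _ _); rewrite ltn_add2l => /(_ im).
move=> /lerD/(_ (IH (ltnW im))) /le_trans; apply.
rewrite addKn -addnS subnDl -mulrDr ler_wpM2l//.
rewrite le_eqVlt; apply/orP; left; apply/eqP.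
have -> : (m - i = (m - i.+1).+1)%N by rewrite subnSK.
rewrite !exprS; field.
have q3 : q * 2 - 1 != 0 by rewrite gt_eqF// subr_gt0 -ltr_pdivrMr// mul1r.
by rewrite q3 !gt_eqF.
Qed.

Lemma defect_ge0 w : 0 <= w -> 0 <= defect d alpha A w.
Proof.
move=> w0; have A0 : 0 <= A by apply: le_trans A_ge1.
have q1 : 0 <= 1 - q by rewrite subr_ge0 ltW.
have q2 : 0 <= q - 2^-1 by rewrite subr_ge0 ltW.
by rewrite addr_ge0// mulr_ge0// ?addr_ge0 ?divr_ge0.
Qed.

Lemma cube_avg_Gamma_dyad_increment m n x e :
  `|cube_avg m n.+1 (F (n + m.+1)) (child n x e) - cube_avg m.+1 n (F (n + m.+1)) x| <=
  defect d alpha A W *+ 3 + W * (A *+ 2).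
Proof.
set c := child n x e.
have E1 := cube_avg_Gamma_dyad m n.+1 c; rewrite addSnnS in E1.
have E2 := cube_avg_Gamma_dyad m.+1 n x.
have E3 : `|F n.+1 c - F n c| <= W * (A *+ 2).
  rewrite window_dyadS addrK; apply: window_bounded; rewrite ?dyad_gt0 ?dyadS//.
  by rewrite -(dyadS n) lerDl ltW// dyad_gt0.
have E4 : `|F n c - F n x| <= defect d alpha A W.
  have cxc : cube n x c by apply: (@cube_child _ _ _ _ e); exact: cube_refl.
  exact: le_trans (Gamma_dyad_cube cxc) oscillation_le_defect.
have -> : cube_avg m n.+1 (F (n + m.+1)) c - cube_avg m.+1 n (F (n + m.+1)) x =
  (cube_avg m n.+1 (F (n + m.+1)) c - F n.+1 c) + (F n.+1 c - F n c) + (F n c - F n x)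
  - (cube_avg m.+1 n (F (n + m.+1)) x - F n x) by ring.
apply: le_trans (ler_normB _ _) _.
apply: le_trans (lerD (ler_normD _ _) (lexx _)) _.
apply: le_trans (lerD (lerD (ler_normD _ _) (lexx _)) (lexx _)) _.
by lra.
Qed.

End AlmostMartingale.

(** * A maximal inequality on the dyadic tree *)

Section MaximalInequality.
Context {R : realType} {d : nat}.
Implicit Types (x y : 'rV[R]_d.+1) (t B lam u c : R).

(** From [exp (- u) >= 1 - u] and [(1 - u) (1 + u + 2 u^2) >= 1]. *)
Lemma expR_le_quadratic u : u <= 2^-1 -> expR u <= 1 + u + 2 * u ^+ 2.
Proof.
move=> u_half; have u1 : 0 < 1 - u by lra.
have : expR (- u) >= 1 - u by exact: expR_ge1Dx.
rewrite expRN -[leLHS]invrK lef_pV2 ?posrE ?expR_gt0 ?invr_gt0// => /le_trans; apply.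
rewrite -[leLHS]mul1r ler_pdivrMr//; have : 0 <= u ^+ 2 * (1 - 2 * u).
  by rewrite mulr_ge0 ?sqr_ge0//; lra.
nra.
Qed.

(** A Hoeffding-type bound: the linear term of the exponential has mean zero
    over the children. *)
Lemma child_mean_expR_le n (S : 'rV[R]_d.+1 -> R) c x t B : 0 <= t -> t * B <= 2^-1 ->
  child_mean n S x = c -> (forall e, `|S (child n x e) - c| <= B) ->
  child_mean n (fun y => expR (t * S y)) x <= expR (t * c + 2 * (t * B) ^+ 2).
Proof.
move=> t0 tB Sc SB.
have -> : expR (t * c + 2 * (t * B) ^+ 2) = expR (t * c) * expR (2 * (t * B) ^+ 2).
  by rewrite expRD.
(* The affine majorant of the exponential, as a difference so that it is
   averaged by linearity. *)
apply: (@le_trans _ _ (child_mean n (fun y => expR (t * c) *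
    ((1 + 2 * (t * B) ^+ 2 - t * c) - (- t) * S y)) x)).
  apply: le_child_mean => e; have -> : t * S (child n x e) = t * c + t * (S (child n x e) - c).
    by ring.
  rewrite expRD ler_wpM2l ?expR_ge0//; set u := t * (S _ - c).
  have uB : `|u| <= t * B by rewrite normrM ger0_norm// ler_wpM2l.
  apply: le_trans (expR_le_quadratic _) _.
    by apply: le_trans tB; apply: le_trans uB; exact: ler_norm.
  have : u ^+ 2 <= (t * B) ^+ 2.
    by rewrite -[u ^+ 2]real_normK ?num_real// lerXn2r ?nnegrE// (le_trans _ uB).
  rewrite {2}/u; lra.
rewrite child_meanZ child_meanB child_mean_cst child_meanZ Sc ler_wpM2l ?expR_ge0//.
by apply: le_trans (expR_ge1Dx _); lra.
Qed.

(** The half-open cube is covered by an open box of three times its side: the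
    lost constant [3^d] is harmless. *)
Lemma lebesgue_outer_cube n x :
  (lebesgue_outer (cube n x) <= ((3 * dyad n) ^+ d.+1)%:E)%E.
Proof.
have D0 := @dyad_gt0 R n.
pose l := x - const_mx (dyad n); pose r := x + const_mx (dyad n *+ 2).
apply: (@le_trans _ _ (lebesgue_outer (open_box l r))).
  apply: lebesgue_outer_le => y xy i; have /andP[? ?] := xy i.
  by rewrite !mxE mulr2n; apply/andP; split; lra.
apply: le_trans (lebesgue_outer_box _) _ => [i|].
  by rewrite !mxE mulr2n; lra.
rewrite lee_fin /box_volume (eq_bigr (fun=> 3 * dyad n)) => [|i _].
  by rewrite prodr_const card_ord.
by rewrite !mxE mulr2n; lra.
Qed.

Lemma lebesgue_outer_big (I : Type) (r : seq I) (F : I -> set 'rV[R]_d.+1) :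
  (lebesgue_outer (\big[setU/set0]_(i <- r) F i) <= \sum_(i <- r) lebesgue_outer (F i))%E.
Proof.
elim: r => [|i r IH]; first by rewrite !big_nil lebesgue_outer0.
by rewrite !big_cons; apply: le_trans (outer_measureU2 _ _ _) _; exact: leeD2l.
Qed.

(** Induction on the height [m] of the tree.  If [S n x >= lam] the bound
    is at least that of the whole cube; otherwise no point of the cube is
    bad at level [n], and [child_mean_expR_le] sums up the bounds for the
    children. *)
Lemma tree_maximal_inequality (S : nat -> 'rV[R]_d.+1 -> R) (N : nat)
    (G : nat -> 'rV[R]_d.+1 -> Prop) B t lam : 0 <= t -> t * B <= 2^-1 ->
  (forall n x, (n < N)%N -> child_mean n (S n.+1) x = S n x) ->
  (forall n x e, (n < N)%N -> `|S n.+1 (child n x e) - S n x| <= B) ->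
  (forall n x y, (n <= N)%N -> cube n x y -> G n y -> lam <= S n x) ->
  forall m n x, (n + m)%N = N ->
  (lebesgue_outer [set y | cube n x y /\ exists2 l, (n <= l <= N)%N & G l y] <=
   ((3 * dyad n) ^+ d.+1 * expR (t * (S n x - lam) + 2 * (t * B) ^+ 2 *+ m))%:E)%E.
Proof.
move=> t0 tB S_mart S_incr S_G; elim=> [|m IH] n x nmN; set bad := [set y | _].
all: have [lamS|Slam] := leP lam (S n x).
1,3: apply: (@le_trans _ _ (lebesgue_outer (cube n x)));
       first by apply: lebesgue_outer_le => y [].
1,2: apply: le_trans (lebesgue_outer_cube n x) _; rewrite lee_fin ler_peMr//;
       first by rewrite exprn_ge0// mulr_ge0// ltW// dyad_gt0.
1,2: rewrite -expR0 ler_expR addr_ge0 ?mulr_ge0 ?subr_ge0//;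
       by rewrite mulrn_wge0// mulr_ge0// sqr_ge0.
  suff -> : bad = set0.
    by rewrite lebesgue_outer0 lee_fin mulr_ge0 ?expR_ge0// exprn_ge0// mulr_ge0// ltW// dyad_gt0.
  apply/seteqP; split => // y [xy [l]]; rewrite -nmN addn0 => /andP[nl ln] Gy.
  have nl' : l = n by apply/eqP; rewrite eqn_leq nl ln.
  by move: (S_G n x y); rewrite -nmN addn0 leqnn leNgt Slam -{2}nl' => /(_ isT xy Gy).
have nN : (n < N)%N by rewrite -nmN addnS ltnS leq_addr.
pose badc e := [set y | cube n.+1 (child n x e) y /\
  exists2 l, (n.+1 <= l <= N)%N & G l y].
apply: (@le_trans _ _ (lebesgue_outer (\big[setU/set0]_e badc e))).
  apply: lebesgue_outer_le => y [xy [l /andP[nl lN] Gy]].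
  have [e ey] := cube_split xy; rewrite (bigD1 e)//=; left; split => //.
  exists l => //; rewrite lN andbT ltn_neqAle nl andbT.
  apply: contraTneq Slam => nl'; rewrite -leNgt; apply: (S_G n x y) => //; first exact: ltnW.
  by rewrite nl'.
apply: le_trans (lebesgue_outer_big _ _) _.
apply: (@le_trans _ _ (\sum_e ((3 * dyad n.+1) ^+ d.+1 * expR
    (t * (S n.+1 (child n x e) - lam) + 2 * (t * B) ^+ 2 *+ m))%:E)%E).
  by apply: lee_sum => e _; apply: IH; rewrite addSnnS.
rewrite sumEFin lee_fin -mulr_sumr.
have -> : (3 * dyad n.+1) ^+ d.+1 = (3 * dyad n) ^+ d.+1 * dyad d.+1 :> R.
  by rewrite -exprMn; congr (_ ^+ _); rewrite [dyad n.+1]exprSr mulrA.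
rewrite -mulrA ler_wpM2l ?exprn_ge0 ?mulr_ge0 ?(ltW (dyad_gt0 n))//.
have -> : dyad d.+1 * \sum_e expR
    (t * (S n.+1 (child n x e) - lam) + 2 * (t * B) ^+ 2 *+ m) =
  expR (2 * (t * B) ^+ 2 *+ m - t * lam) * child_mean n (fun y => expR (t * S n.+1 y)) x.
  rewrite -child_meanZ /child_mean; congr (_ * _); apply: eq_bigr => e _.
  by rewrite -expRD; congr expR; ring.
have := child_mean_expR_le t0 tB (S_mart n x nN) (fun e => S_incr n x e nN).
move=> /(ler_wpM2l (expR_ge0 (2 * (t * B) ^+ 2 *+ m - t * lam))) /le_trans; apply.
by rewrite -expRD ler_expR mulrSr le_eqVlt; apply/orP; left; apply/eqP; ring.
Qed.

End MaximalInequality.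

(** * A law of the iterated logarithm for almost-martingales *)

Section NullSets.
Context {R : realType} {d : nat}.
Implicit Types (x y : 'rV[R]_d.+1) (t B K c : R).

Lemma sum_inv_sqr_le (j n : nat) : (0 < j)%N ->
  \sum_(0 <= i < n) (j.+1 + i)%:R ^- 2 <= j%:R^-1 - (j + n)%:R^-1 :> R.
Proof.
move=> j0; elim: n => [|n IH]; first by rewrite big_geq// addn0 subrr.
rewrite big_nat_recr//=; apply: le_trans (lerD IH (lexx _)) _.
rewrite addSn addnS -natr1; have jn : 0 < (j + n)%:R :> R by rewrite ltr0n addn_gt0 j0.
move: jn; move: ((j + n)%:R : R) => u u0; have u1 : 0 < u + 1 by rewrite addr_gt0.
have : (u + 1) ^- 2 <= (u * (u + 1))^-1.
  by rewrite lef_pV2 ?posrE ?exprn_gt0 ?mulr_gt0// expr2 ler_pM2r// lerDl.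
have -> : (u * (u + 1))^-1 = u^-1 - (u + 1)^-1 by field; rewrite !gt_eqF.
by lra.
Qed.

Lemma borel_cantelli_outer c (E : nat -> set 'rV[R]_d.+1) : 0 <= c ->
  (forall k, (4 <= k)%N -> (lebesgue_outer (E k) <= (c * k%:R ^- 2)%:E)%E) ->
  lebesgue_outer [set y | forall k0, exists2 k, (k0 <= k)%N & E k y] = 0%E.
Proof.
move=> c0 Ec; apply/eqP; rewrite eq_le lebesgue_outer_ge0 andbT.
apply/lee_addgt0Pr => e e0; rewrite add0e.
(* The tail of the series of inverse squares beyond j is at most 1 / j. *)
set j := (Num.truncn (c / e)).+4.
have cj : c / j%:R <= e.
  rewrite ler_pdivrMr ?ltr0n// mulrC -ler_pdivrMr//.
  have /andP[_ /ltW/le_trans] := truncn_itv (divr_ge0 c0 (ltW e0)); apply.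
  by rewrite ler_nat /j !ltnS (leq_trans (leqnSn _))// ltnW.
apply: (@le_trans _ _ (lebesgue_outer (\bigcup_i E (j.+1 + i)%N))).
  apply: lebesgue_outer_le => y /(_ j.+1)[k jk Ek].
  by exists (k - j.+1)%N => //; rewrite subnKC.
apply: le_trans (lebesgue_outer_sigma_subadditive _) _.
apply: lime_le.
  by apply: is_cvg_nneseries => k _ _; exact: lebesgue_outer_ge0.
apply: nearW => n.
apply: (@le_trans _ _ (\sum_(0 <= i < n) (c * (j.+1 + i)%:R ^- 2)%:E)%E).
  by apply: lee_sum => i _; apply: Ec.
rewrite sumEFin lee_fin -mulr_sumr; apply: le_trans _ cj.
rewrite ler_wpM2l//; apply: le_trans (sum_inv_sqr_le _ _) _ => //.
by rewrite gerBl invr_ge0.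
Qed.

(** A set is null as soon as its trace on each unit cube is, since the cubes
    with integer corners are countably many. *)
Lemma lebesgue_outer_unit_cubes (A : set 'rV[R]_d.+1) :
  (forall x, lebesgue_outer (A `&` cube 0 x) = 0%E) -> lebesgue_outer A = 0%E.
Proof.
move=> A0; apply/eqP; rewrite eq_le lebesgue_outer_ge0 andbT.
pose base k : 'rV[R]_d.+1 := if unpickle k is Some z then map_mx intr (z : 'rV[int]_d.+1) else 0.
apply: (@le_trans _ _ (lebesgue_outer (\bigcup_k (A `&` cube 0 (base k))))).
  apply: lebesgue_outer_le => y Ay.
  exists (pickle (map_mx Num.floor y)) => //; split => // i.
  rewrite /base pickleK !mxE /dyad expr0; apply/andP; split.
    exact: floor_le_tmp.
  by have := floorD1_gt (y ord0 i); rewrite intrD.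
apply: le_trans (lebesgue_outer_sigma_subadditive _) _.
by rewrite eseries0.
Qed.

End NullSets.

Section DyadicLIL.
Context {R : realType} {d : nat}.
Implicit Types (x y : 'rV[R]_d.+1) (B K : R).
Implicit Types (F S : nat -> 'rV[R]_d.+1 -> R).

(** [S] is a martingale on the dyadic tree down to level [N], with increments
    at most [B], that stays within [K] of [F] and starts within [K] of 0.  The
    starting condition makes the estimates uniform over the unit cubes. *)
Definition martingale_approx B K F (N : nat) S :=
  [/\ forall n x, (n < N)%N -> child_mean n (S n.+1) x = S n x,
      forall n x e, (n < N)%N -> `|S n.+1 (child n x e) - S n x| <= B,
      forall n x y, (n <= N)%N -> cube n x y -> `|F n y - S n x| <= K &
      forall x, `|S 0 x| <= K].

Lemma martingale_approxN B K F N S : martingale_approx B K F N S ->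
  martingale_approx B K (fun n y => - F n y) N (fun n x => - S n x).
Proof.
move=> [S_mart S_incr S_F S0]; split => [n x nN|n x e nN|n x y nN xy|x].
- rewrite -(S_mart n x nN) -[RHS]mulN1r -child_meanZ; congr child_mean.
  by apply/funext => y; rewrite mulN1r.
- by rewrite -opprD normrN S_incr.
- by rewrite -opprD normrN S_F.
- by rewrite normrN S0.
Qed.

(** The level that a walk with [2^k] steps of size at most [B] rarely crosses;
    the factor 4 makes the probability of crossing it of order [k^-2]. *)
Definition threshold B (k : nat) : R := 4 * B * Num.sqrt (2 ^+ k * ln k%:R).

Definition exceedance F (N : nat) (h : R) x : set 'rV[R]_d.+1 :=
  [set y | cube 0 x y /\ exists2 l, (l <= N)%N & h < F l y].

Lemma ln_le_pow2 (k : nat) : (4 <= k)%N -> 4 * ln k%:R <= 2 ^+ k :> R.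
Proof.
move=> k4; apply: (@le_trans _ _ (4 * k%:R)).
  by rewrite ler_pM2l// ltW// ln_sublinear// ltr0n (leq_trans _ k4).
rewrite -natrX -natrM ler_nat.
elim: k k4 => // k IH; rewrite leq_eqVlt => /predU1P[<-//|]; rewrite ltnS => k4.
by have := IH k4; rewrite expnS; lia.
Qed.

(** [tree_maximal_inequality] with [t = sqrt (ln k / 2^k) / B]: the exponent
    is at most [K / B - 4 ln k + 2 ln k]. *)
Lemma exceedance_upper B K F k S x : 0 < B -> 0 <= K -> (4 <= k)%N ->
  martingale_approx B K F (2 ^ k) S ->
  (lebesgue_outer (exceedance F (2 ^ k) (threshold B k + K) x) <=
   (3 ^+ d.+1 * expR (K / B) * k%:R ^- 2)%:E)%E.
Proof.
move=> B0 K0 k4 [S_mart S_incr S_F S0].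
have k0 : 0 < k%:R :> R by rewrite ltr0n (leq_trans _ k4).
have lnk0 : 0 <= ln k%:R :> R by rewrite ln_ge0// ler1n (leq_trans _ k4).
have N0 : 0 < 2 ^+ k :> R by rewrite exprn_gt0.
pose r := Num.sqrt (ln k%:R / 2 ^+ k) : R; pose t := r / B.
have r0 : 0 <= r by exact: sqrtr_ge0.
have t0 : 0 <= t by rewrite divr_ge0// ltW.
have tB : t * B = r by rewrite divfK// gt_eqF.
have r_half : r <= 2^-1.
  rewrite -[leRHS]ger0_norm// -sqrtr_sqr ler_wsqrtr// ler_pdivrMr//.
  by have := ln_le_pow2 k4; rewrite expr2; lra.
have r2 : r ^+ 2 * 2 ^+ k = ln k%:R.
  by rewrite sqr_sqrtr ?divr_ge0 ?(ltW N0)// divfK// gt_eqF.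
have rth : t * threshold B k = 4 * ln k%:R.
  have -> : t * threshold B k = 4 * (r * Num.sqrt (2 ^+ k * ln k%:R)).
    by rewrite /threshold /t; field; rewrite gt_eqF.
  rewrite -sqrtrM ?divr_ge0 ?(ltW N0)// [_ / _ * _]mulrA divfK ?gt_eqF//.
  by rewrite -expr2 sqrtr_sqr ger0_norm.
have tB_half : t * B <= 2^-1 by rewrite tB.
have S_G n z y : (n <= 2 ^ k)%N -> cube n z y -> threshold B k + K < F n y ->
    threshold B k <= S n z.
  move=> nN zy Fy; have := S_F n z y nN zy; rewrite ler_norml => /andP[_]; lra.
have := tree_maximal_inequality (G := fun l y => threshold B k + K < F l y)
  t0 tB_half S_mart S_incr S_G x (add0n (2 ^ k)%N).
move=> /le_trans; apply; rewrite lee_fin /dyad expr0 mulr1 -mulrA.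
rewrite ler_wpM2l ?exprn_ge0// tB.
have -> : k%:R ^- 2 = expR (- (ln k%:R *+ 2)) :> R.
  by rewrite expRN -lnXn// lnK// posrE exprn_gt0.
rewrite -expRD ler_expR -mulr_natr natrX -mulrA r2 mulrBr rth.
have : t * S 0 x <= K / B.
  apply: (@le_trans _ _ (t * K)).
    by rewrite ler_wpM2l//; apply: le_trans (S0 x); exact: ler_norm.
  rewrite /t mulrAC [r * K]mulrC ler_pM2r ?invr_gt0// ler_piMr//.
  by apply: le_trans r_half _; rewrite invf_le1// ler1n.
rewrite mulr2n; lra.
Qed.

(** Borel-Cantelli along the horizons [2^k], for [F] and for [- F]. *)
Lemma dyadic_lil B K F : 0 < B -> 0 <= K ->
  (forall N, exists S, martingale_approx B K F N S) ->
  lebesgue_outer [set y | ~ exists k0, forall k, (k0 <= k)%N ->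
     forall l, (l <= 2 ^ k)%N -> `|F l y| <= threshold B k + K] = 0%E.
Proof.
move=> B0 K0 FS; apply: lebesgue_outer_unit_cubes => x.
pose up G k := exceedance G (2 ^ k) (threshold B k + K) x.
pose E k := up F k `|` up (fun l y => - F l y) k.
apply/eqP; rewrite eq_le lebesgue_outer_ge0 andbT.
set c := 3 ^+ d.+1 * expR (K / B).
have c0 : 0 <= c *+ 2 by rewrite mulrn_wge0// mulr_ge0 ?exprn_ge0 ?expR_ge0.
rewrite -(@borel_cantelli_outer _ _ (c *+ 2) E) => [| |k k4].
- apply: lebesgue_outer_le => y [nlil xy] k0; apply: contrapT => nE; apply: nlil.
  exists k0 => k kk l lk; rewrite leNgt; apply/negP => Fl; apply: nE; exists k => //.
  have [F0|F0] := leP 0 (F l y); [left|right]; split => //; exists l => //.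
    by rewrite -(ger0_norm F0).
  by rewrite -(ltr0_norm F0).
- exact: c0.
have [S FSk] := FS (2 ^ k)%N.
apply: le_trans (outer_measureU2 _ _ _) _; rewrite mulr2n mulrDl EFinD.
by apply: leeD; apply: exceedance_upper => //; [exact: FSk|exact: martingale_approxN FSk].
Qed.

End DyadicLIL.

(** * Comparison with the gauge *)

Section Asymptotics.
Context {R : realType}.
Implicit Types (eps B : R).

Lemma dyad_le m n : (m <= n)%N -> dyad n <= dyad m :> R.
Proof. by move=> mn; rewrite ler_wiXn2l// invf_le1// ler1n. Qed.

Lemma ln2_ge_half : 2^-1 <= ln 2 :> R.
Proof.
rewrite -ler_expR lnK ?posrE//; apply: le_trans (expR_le_quadratic (lexx _)) _.
by rewrite expr2; lra.
Qed.

Lemma dyadic_scale eps : 0 < eps -> eps < 1 ->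
  exists l, dyad l.+1 <= eps < dyad l.
Proof.
move=> e0 e1; have ex : exists n, dyad n <= eps.
  have ei : 0 <= eps^-1 by rewrite invr_ge0 ltW.
  exists (Num.truncn eps^-1).+1; rewrite /dyad exprVn invf_ple ?posrE ?exprn_gt0//.
  have /andP[_ /ltW/le_trans] := truncn_itv ei.
  by apply; rewrite -natrX ler_nat ltnW// ltn_expl.
case: (ex_minnP ex) => -[|l] le_l min_l.
  by move: le_l; rewrite /dyad expr0 leNgt e1.
exists l; rewrite le_l ltNge; apply/negP => /min_l; by rewrite ltnn.
Qed.

(** [ln (1/eps) >= l / 2 >= 2^(k-2)], hence
    [ln ln ln (1/eps) >= ln ((k-2)/2) >= ln (sqrt k)], the last step because
    [k >= 8]. *)
Lemma log3_gauge_ge eps (k l : nat) : (8 <= k)%N -> (2 ^ k.-1 <= l)%N ->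
  0 < eps -> eps <= dyad l -> l%:R * ln k%:R / 4 <= log3_gauge eps ^+ 2.
Proof.
move=> k8 kl e0 el; have ln2 := ln2_ge_half.
have k0 : 0 < k%:R :> R by rewrite ltr0n (leq_trans _ k8).
set u := ln eps^-1.
have ul : l%:R / 2 <= u.
  apply: (@le_trans _ _ (ln (2 ^+ l))).
    by rewrite lnXn// -[ln 2 *+ l]mulr_natl ler_wpM2l.
  by rewrite ler_ln ?posrE ?exprn_gt0 ?invr_gt0// -[leLHS]invrK -exprVn lef_pV2 ?posrE ?exprn_gt0.
have uk : 2 ^+ (k - 2) <= u.
  apply: le_trans ul; rewrite ler_pdivlMr// -exprSr -natrX ler_nat.
  by apply: leq_trans kl; rewrite leq_exp2l//; lia.
have u0 : 0 < u by apply: lt_le_trans uk; rewrite exprn_gt0.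
have lnu : (k - 2)%:R / 2 <= ln u.
  apply: (@le_trans _ _ (ln (2 ^+ (k - 2)))); last by rewrite ler_ln ?posrE ?exprn_gt0.
  by rewrite lnXn// -[ln 2 *+ _]mulr_natl ler_wpM2l.
have k2 : 0 < (k - 2)%:R / 2 :> R by rewrite divr_gt0// ltr0n; lia.
have lnu0 : 0 < ln u by apply: lt_le_trans lnu.
have lnlnu : ln k%:R / 2 <= ln (ln u).
  apply: (@le_trans _ _ (ln ((k - 2)%:R / 2))); last by rewrite ler_ln ?posrE.
  rewrite ler_pdivrMr// mulr_natr -lnXn// ler_ln ?posrE ?exprn_gt0//.
  rewrite expr_div_n ler_pdivlMr ?exprn_gt0// -!natrX -natrM ler_nat.
  have [j ->] : exists j, k = (j + 8)%N by exists (k - 8)%N; rewrite subnK.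
  by rewrite -addnBA//; nia.
have lnk0 : 0 <= ln k%:R :> R by rewrite ln_ge0// ler1n (leq_trans _ k8).
rewrite /log3_gauge -/u sqr_sqrtr; last first.
  by rewrite mulr_ge0 ?(ltW u0)//; apply: le_trans lnlnu; rewrite divr_ge0.
have -> : l%:R * ln k%:R / 4 = l%:R / 2 * (ln k%:R / 2) :> R by field.
by rewrite ler_pM ?divr_ge0.
Qed.

Lemma log3_gauge_dominates eps B (k l : nat) : 0 <= B -> (8 <= k)%N ->
  (2 ^ k.-1 <= l)%N -> 0 < eps -> eps <= dyad l ->
  1 <= log3_gauge eps /\ threshold B k <= 12 * B * log3_gauge eps.
Proof.
move=> B0 k8 kl e0 el; have g2 := log3_gauge_ge k8 kl e0 el.
have g0 : 0 <= log3_gauge eps by exact: sqrtr_ge0.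
have lnk : 2^-1 <= ln k%:R :> R.
  apply: le_trans ln2_ge_half _; rewrite ler_ln ?posrE ?ltr0n ?ler_nat//; lia.
have l8 : 8 <= l%:R :> R.
  rewrite ler_nat; apply: leq_trans kl; apply: (@leq_trans (2 ^ 7)) => //.
  by rewrite leq_exp2l//; lia.
split.
  rewrite -(@ler_pXn2r _ 2)// ?nnegrE// expr1n; apply: le_trans g2.
  rewrite ler_pdivlMr// mul1r; apply: (@le_trans _ _ (8 * 2^-1)); first lra.
  by apply: ler_pM.
rewrite /threshold.
have -> : 12 * B * log3_gauge eps = 4 * B * (3 * log3_gauge eps) by ring.
rewrite ler_wpM2l ?mulr_ge0// -[leRHS]ger0_norm ?mulr_ge0// -sqrtr_sqr ler_wsqrtr//.
apply: (@le_trans _ _ (2 * l%:R * ln k%:R)).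
  rewrite ler_wpM2r//; first by apply: le_trans lnk.
  rewrite -natrX -natrM ler_nat -(prednK (leq_trans _ k8))// expnS leq_mul2l.
  by rewrite kl.
rewrite exprMn; nra.
Qed.

End Asymptotics.

(** * The theorem *)

Section GammaLIL.
Context {R : realType} {d p : nat}.
Context (alpha : R) (a : 'I_p -> 'rV[R]_d.+1) (mu : 'I_p -> R).
Context (f : 'rV[R]_d.+1 -> R) (M A : R).
Context (alpha_gt0 : 0 < alpha) (alpha_lt1 : alpha < 1).
Context (mu_sum0 : \sum_i mu i = 0).
Context (M_ge0 : 0 <= M) (f_holder : holder M alpha f).
Context (A_ge1 : 1 <= A) (a_le : forall i, l1norm (a i) <= A).

Local Notation W := ((\sum_i `|mu i|) * M).
Local Notation F n := (window alpha a mu (dyad n) 1 f).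
Local Notation K := (defect d.+1 alpha A W).

(** The summand 1 only serves to make the bound on the increments positive. *)
Lemma Gamma_martingale_approx N :
  martingale_approx (K *+ 3 + W * (A *+ 2) + 1) (K *+ 2) (fun n => F n) N
    (fun n => cube_avg (N - n) n (F N)).
Proof.
have near_S n x : (n <= N)%N -> `|cube_avg (N - n) n (F N) x - F n x| <= K.
  by move=> nN; rewrite -{2}(subnKC nN); apply: cube_avg_Gamma_dyad.
split=> [n x nN|n x e nN|n x y nN xy|x].
- by rewrite -(subnSK nN).
- apply: (@le_trans _ _ (K *+ 3 + W * (A *+ 2))); last by rewrite lerDl.
  rewrite -(subnSK nN).
  (* Only the horizons are rewritten, not the heights of the trees. *)
  have {2 4}-> : N = (n + (N - n.+1).+1)%N by rewrite subnSK// subnKC// ltnW.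
  exact: cube_avg_Gamma_dyad_increment.
- have -> : F n y - cube_avg (N - n) n (F N) x =
      (F n y - F n x) - (cube_avg (N - n) n (F N) x - F n x) by ring.
  apply: le_trans (ler_normB _ _) _; rewrite mulr2n; apply: lerD; last exact: near_S.
  apply: (@le_trans _ _ (W * (d.+2%:R / (1 - decay alpha)))).
    exact: Gamma_dyad_cube.
  exact: oscillation_le_defect.
- have := near_S 0%N x (leq0n N); rewrite window_dyad0 subr0 => /le_trans; apply.
  rewrite mulr2n lerDl; apply: defect_ge0 => //.
  by rewrite mulr_ge0// sumr_ge0.
Qed.

(** A small [eps] is compared with the dyadic scale just above it and with the
    power of 2 just above the index of that scale; constants are absorbed as
    the gauge is at least 1. *)
Lemma Gamma_limsup_le (B D : R) y : 0 <= B -> 0 <= D ->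
  (exists k0, forall k, (k0 <= k)%N -> forall l, (l <= 2 ^ k)%N ->
     `|F l y| <= threshold B k + D) ->
  (limf_esup (fun eps : R => (`|Gamma alpha a mu f eps y| / log3_gauge eps)%:E) 0^'+
   <= (12 * B + D + W * (A *+ 2))%:E)%E.
Proof.
move=> B0 D0 [k0 Fk]; have W0 : 0 <= W by rewrite mulr_ge0// sumr_ge0.
have WA0 : 0 <= W * (A *+ 2) by rewrite mulr_ge0// mulrn_wge0// (le_trans _ A_ge1).
pose k1 := (k0 + 8)%N.
pose V : set R := [set eps | 0 < eps] `&` [set eps | eps < dyad (2 ^ k1)].
apply: (@le_trans _ _ (ereal_sup
    ((fun eps : R => (`|Gamma alpha a mu f eps y| / log3_gauge eps)%:E) @` V))).
  apply: ereal_inf_lbound; exists V => //.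
  by apply: filterI; [exact: nbhs_right_gt|apply: nbhs_right_lt; exact: dyad_gt0].
apply: ge_ereal_sup => _ [eps [/= e0 e1] <-]; rewrite lee_fin.
have eps1 : eps < 1.
  by apply: lt_le_trans e1 (dyad_le1 _).
have [l /andP[le_l lt_l]] := dyadic_scale e0 eps1.
have k1l : (2 ^ k1 <= l)%N.
  rewrite leqNgt; apply/negP => lk.
  by have := lt_le_trans e1 (le_trans (dyad_le lk) le_l); rewrite ltxx.
have l0 : (0 < l)%N by apply: leq_trans k1l; rewrite expn_gt0.
have [k /andP[kl lk]] : exists k, (2 ^ k.-1 <= l < 2 ^ k)%N.
  by exists (trunc_log 2 l).+1; exact: trunc_log_bounds.
have k1k : (k1 < k)%N by rewrite -(@ltn_exp2l 2)//; exact: leq_ltn_trans lk.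
have k8 : (8 <= k)%N by apply: leq_trans (ltnW k1k); rewrite leq_addl.
have [g1 gB] : 1 <= log3_gauge eps /\ threshold B k <= 12 * B * log3_gauge eps.
  exact: log3_gauge_dominates B0 k8 kl e0 (ltW lt_l).
have g0 : 0 < log3_gauge eps by apply: lt_le_trans g1.
have Fl : `|F l y| <= threshold B k + D.
  by apply: Fk (ltnW lk); apply: leq_trans (ltnW k1k); rewrite leq_addr.
rewrite ler_pdivrMr// GammaE.
have -> : window alpha a mu eps 1 f y =
    window alpha a mu eps (dyad l) f y + F l y.
  apply: (@window_split _ _ _ _ _ _ alpha_gt0 M) => //; first exact: ltW.
  exact: dyad_le1.
apply: le_trans (ler_normD _ _) _.
have : `|window alpha a mu eps (dyad l) f y| <= W * (A *+ 2).
  apply: window_bounded => //; first exact: ltW.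
  by rewrite -(dyadS l) lerD.
move: (W * (A *+ 2)) WA0 => w w0 Ww.
apply: le_trans (lerD Ww Fl) _; rewrite !mulrDl.
have := ler_peMr w0 g1; have := ler_peMr D0 g1; lra.
Qed.

End GammaLIL.

(* The bound scales linearly in mu, so C has to depend on the size of mu; it
   does so only through L, and otherwise on d, alpha, M and a alone. *)
Theorem corollary1p1 (R : realType) (d p : nat) (alpha : R)
    (a : 'I_p -> 'rV[R]_d) (M L : R)
    (d_gt0 : (0 < d)%N) (alpha_gt0 : 0 < alpha) (alpha_lt1 : alpha < 1) :
  exists2 C : R, 0 < C &
    forall (f : 'rV[R]_d -> R) (mu : 'I_p -> R),
      Lambda alpha f ->
      holder_norm alpha f = M%:E ->
      \sum_(i < p) mu i = 0 ->
      \sum_(i < p) `|mu i| = L ->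
      almost_all (fun x : 'rV[R]_d =>
        (limf_esup
           (fun eps : R => (`|Gamma alpha a mu f eps x| / log3_gauge eps)%:E)
           0^'+ <= C%:E)%E).
Proof.
case: d a d_gt0 => // d a _.
(* A bound for all the displacements, at least 1 so that A ^ alpha <= A. *)
pose A := 1 + \sum_i l1norm (a i).
have a_sum0 : 0 <= \sum_i l1norm (a i) by apply: sumr_ge0 => i _; exact: l1norm_ge0.
have A_ge1 : 1 <= A by rewrite lerDl.
have a_le i : l1norm (a i) <= A.
  rewrite /A (bigD1 i)//= addrCA lerDl addr_ge0// sumr_ge0// => j _; exact: l1norm_ge0.
(* L and M are not assumed nonnegative, and C has to be positive in any case. *)
pose w := `|L| * `|M|; pose K := defect d.+1 alpha A w.
pose B := K *+ 3 + w * (A *+ 2) + 1.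
have w0 : 0 <= w by rewrite mulr_ge0.
have K0 : 0 <= K by apply: defect_ge0.
have wA0 : 0 <= w * (A *+ 2) by rewrite mulr_ge0// mulrn_wge0// (le_trans _ A_ge1).
have B0 : 0 < B by rewrite ltr_wpDl// addr_ge0// mulrn_wge0.
exists (12 * B + K *+ 2 + w * (A *+ 2)).
  by rewrite ltr_wpDr// ltr_wpDr ?mulrn_wge0// mulr_gt0.
move=> f mu _ fM mu0 muL.
have f_holder := holder_of_norm alpha_gt0 fM.
have wE : (\sum_i `|mu i|) * `|M| = w.
  by rewrite muL /w (@ger0_norm _ L)// -muL sumr_ge0.
apply/eqP; rewrite eq_le lebesgue_outer_ge0 andbT.
rewrite -(@dyadic_lil _ _ B (K *+ 2)
  (fun n => window alpha a mu (dyad n) 1 f))// ?mulrn_wge0//; last first.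
  move=> N; exists (fun n => cube_avg (N - n) n (window alpha a mu (dyad N) 1 f)).
  by rewrite /B /K -wE; apply: Gamma_martingale_approx.
apply: lebesgue_outer_le => y nlim lil; apply: nlim.
rewrite /= -wE; apply: Gamma_limsup_le => //; first exact: ltW.
by rewrite mulrn_wge0.
Qed.
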